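(* Let $0\le k\le m$ and $0\le l\le n$ be integers. For all $k|l$-indices $I|R$, $J|S$, $K|T$, the transition morphisms $g_{I|R,J|S}$ between the superdomains $U_{I|R}$ satisfy: (1) $g_{I|R,I|R}=\mathrm{id}$; (2) $g_{I|R,J|S}\, g_{J|S,I|R}=\mathrm{id}$; (3) $g_{I|R,J|S}\, g_{J|S,K|T}\, g_{K|T,I|R}=\mathrm{id}$. Here products are compositions read from left to right (the leftmost morphism is applied first), and each identity holds on the open subsupermanifold of $U_{I|R}$ on which the composite is defined.
   Context: A supermanifold of dimension $p|q$ is a pair $(|M|,\mathcal{O}_M)$ with $|M|$ a second countable Hausdorff space and $\mathcal{O}_M$ a sheaf of $\mathbb{Z}_2$-graded algebras locally isomorphic to $C^\infty(\mathbb{R}^p)\otimes\wedge\mathbb{R}^q$. A morphism is a continuous map together with a pullback sheaf morphism. A morphism from a supermanifold to (an open part of) $\mathbb{R}^{p|q}$ is determined by the pullbacks of the $p$ even and $q$ odd global coordinates. Put $\alpha=k(m-k)+l(n-l)$ and $\beta=l(m-k)+k(n-l)$. A $k|l$-index $I|R$ consists of $I\subset\{1,\dots,m\}$ with $|I|=k$ and $R\subset\{m+1,\dots,m+n\}$ with $|R|=l$. For each such index let $U_{I|R}=(\mathbb{R}^\alpha, C^\infty(\mathbb{R}^\alpha)\otimes\wedge\mathbb{R}^\beta)$ be a copy of the superdomain $\mathbb{R}^{\alpha|\beta}$. Supermatrices of size $k|l\times m|n$ have $k+l$ rows and $m+n$ columns, in four blocks. The upper left ($k\times m$) and lower right ($l\times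 n$) blocks are called even, and the other two are called odd. An even supermatrix has even entries in the even blocks and odd entries in the odd blocks. For such a supermatrix $Y$: - $M_{J|S}(Y)$ denotes the $(k+l)\times(k+l)$ submatrix formed by the columns with indices in $J\cup S$, in increasing order; - $D_{J|S}(Y)$ denotes the matrix remaining after deleting these columns. The superdomain $U_{I|R}$ is labeled by the even $k|l\times m|n$ supermatrix $A_{I|R}$ such that $M_{I|R}(A_{I|R})$ is the identity matrix and the remaining columns are filled, top to bottom within each column and columns left to right, with the free even generators (coordinates) of $U_{I|R}$ in the even blocks and the free odd generators in the odd blocks. Transition morphisms: let $U_{I|R}^{\cap J|S}$ be the open subsupermanifold of $U_{I|R}$ on which $M_{J|S}(A_{I|R})$ is invertible (the paper denotes its underlying space by $|U_{I|R}|\cap|U_{J|S}|$). Then $g_{I|R,J|S}: U_{I|R}^{\cap J|S}\to U_{J|S}^{\cap I|R}$ is the morphism whose pullback sends the coordinates of $U_{J|S}$, i.e. the entries of $D_{J|S}(A_{J|S})$, to the corresponding entries of the matrix $$D_{J|S}\Big(\big(M_{J|S}(A_{I|R})\big)^{-1}A_{I|R}\Big).$$ *)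

(* Defs.v *)
From HB Require Import structures.
From mathcomp Require Import all_boot all_order all_algebra.
From mathcomp Require Import zify.

Set Implicit Arguments.
Unset Strict Implicit.
Unset Printing Implicit Defensive.

Import Order.TTheory GRing.Theory Num.Theory.

Local Open Scope ring_scope.

(* [grassmann A q] is [A] tensored with the exterior algebra on [q] generators:
   [a : grassmann A q] stands for the sum over [K] of [a K * theta_K], where
   [theta_K] is the product of the generators [theta_i], [i \in K], taken in
   increasing order. *)
Definition grassmann (A : Type) (q : nat) : Type := {ffun {set 'I_q} -> A}.

HB.instance Definition _ (A : nmodType) q :=
  GRing.Nmodule.copy (grassmann A q) {ffun {set 'I_q} -> A}.
HB.instance Definition _ (A : zmodType) q :=
  GRing.Zmodule.copy (grassmann A q) {ffun {set 'I_q} -> A}.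
HB.instance Definition _ (R : pzRingType) (A : lmodType R) q :=
  GRing.Lmodule.copy (grassmann A q) {ffun {set 'I_q} -> A}.

Section GrassmannRing.
Variables (A : comPzRingType) (q : nat).
Implicit Types (I J K : {set 'I_q}) (a b c : grassmann A q).

(* theta_I * theta_J = (-1) ^+ gr_inv I J * theta_(I :|: J)
   when I and J are disjoint, and 0 otherwise. *)
Definition gr_inv I J : nat := \sum_(i in I) \sum_(j in J) (j < i).

Definition gr_one : grassmann A q := [ffun K => (K == set0)%:R].

Definition gr_mul a b : grassmann A q :=
  [ffun K : {set 'I_q} => \sum_(I : {set 'I_q} | I \subset K)
     (-1) ^+ gr_inv I (K :\: I) * (a I * b (K :\: I))].

Lemma gr_inv0l J : gr_inv set0 J = 0%N.
Proof. by rewrite /gr_inv big_set0. Qed.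

Lemma gr_inv0r I : gr_inv I set0 = 0%N.
Proof. by rewrite /gr_inv big1 // => i _; rewrite big_set0. Qed.

Lemma sum_setUd (F : 'I_q -> nat) I J : [disjoint I & J] ->
  \sum_(i in I :|: J) F i = (\sum_(i in I) F i + \sum_(i in J) F i)%N.
Proof. by move=> dIJ; rewrite -bigU //; apply: eq_bigl => i; rewrite !inE. Qed.

Lemma gr_invUl I J K : [disjoint I & J] ->
  gr_inv (I :|: J) K = (gr_inv I K + gr_inv J K)%N.
Proof. exact: sum_setUd. Qed.

Lemma gr_invUr I J K : [disjoint J & K] ->
  gr_inv I (J :|: K) = (gr_inv I J + gr_inv I K)%N.
Proof.
move=> dJK; rewrite /gr_inv -big_split /=.
by apply: eq_bigr => i _; exact: sum_setUd.
Qed.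

Lemma gr_mul1l : left_id gr_one gr_mul.
Proof.
move=> a; apply/ffunP => K; rewrite ffunE (bigD1 set0) ?sub0set //=.
rewrite big1 => [|I /andP[_ /negPf I0]]; last by rewrite ffunE I0 mul0r mulr0.
by rewrite setD0 gr_inv0l ffunE eqxx !mul1r addr0.
Qed.

Lemma gr_mul1r : right_id gr_one gr_mul.
Proof.
move=> a; apply/ffunP => K; rewrite ffunE (bigD1 K) //=.
rewrite big1 => [|I /andP[sIK IK]].
  by rewrite setDv gr_inv0r ffunE eqxx mulr1 mul1r addr0.
rewrite ffunE setD_eq0; case: (boolP (K \subset I)) => sKI.
  by case/eqP: IK; apply/eqP; rewrite eqEsubset sIK.
by rewrite !mulr0.
Qed.

Lemma gr_mulDl : left_distributive gr_mul +%R.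
Proof.
move=> a b c; apply/ffunP => K; rewrite !ffunE -big_split /=.
by apply: eq_bigr => I _; rewrite ffunE mulrDl mulrDr.
Qed.

Lemma gr_mulDr : right_distributive gr_mul +%R.
Proof.
move=> a b c; apply/ffunP => K; rewrite !ffunE -big_split /=.
by apply: eq_bigr => I _; rewrite ffunE !mulrDr.
Qed.

Lemma gr_mulA : associative gr_mul.
Proof.
move=> a b c; apply/ffunP => K; rewrite !ffunE.
under eq_bigr do rewrite ffunE 2!mulr_sumr.
under [RHS]eq_bigr do rewrite ffunE mulr_suml mulr_sumr.
rewrite [RHS](exchange_big_dep (fun I : {set 'I_q} => I \subset K)) /=; last first.
  by move=> L I sLK sIL; exact: subset_trans sIL sLK.
apply: eq_bigr => I sIK.
rewrite [RHS](reindex_onto (fun J => I :|: J) (fun L => L :\: I)) /=; last first.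
  by move=> L /andP[_ sIL]; rewrite -{1}(setIidPr sIL) setID.
have DE J : [disjoint J & I] -> (I :|: J) :\: I = J.
  by move=> dJI; rewrite setDUl setDv set0U; apply/setDidPl.
apply: eq_big => [J|J].
  rewrite subsetUl andbT subsetD subUset sIK /= andbC.
  case: (boolP [disjoint J & I]) => [dJI|ndJI] /=; first by rewrite DE ?eqxx ?andbT.
  apply/esym/negbTE; rewrite negb_and; apply/orP; right.
  apply: contra ndJI => /eqP <-; rewrite disjoint_sym -setI_eq0; apply/eqP/setP => x.
  by rewrite !inE; case: (x \in I).
rewrite subsetD => /andP[sJK dJI]; rewrite DE // setDDl.
set T := K :\: (I :|: J).
have dJT : [disjoint J & T].
  by rewrite -setI_eq0; apply/eqP/setP => x; rewrite !inE; case: (x \in J); rewrite ?orbT.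
have -> : K :\: I = J :|: T.
  apply/setP => x; rewrite !inE; have := subsetP sJK x; have := disjointFr dJI (x:=x).
  by case: (x \in I); case: (x \in J); case: (x \in K) => //= H1 H2;
     move: (H1 isT) (H2 isT).
rewrite gr_invUr // gr_invUl 1?disjoint_sym //.
rewrite !mulrA; congr (_ * _).
rewrite [X in X * b J]mulrAC -!exprD; congr (_ ^+ _ * _ * _).
by rewrite [(gr_inv I J + _)%N]addnC -!addnA; congr (_ + _)%N; rewrite addnC.
Qed.

End GrassmannRing.

HB.instance Definition _ (A : comPzRingType) q :=
  GRing.Zmodule_isPzRing.Build (grassmann A q)
    (@gr_mulA A q) (@gr_mul1l A q) (@gr_mul1r A q) (@gr_mulDl A q) (@gr_mulDr A q).

(* [has_parity false a]: [a] is even; [has_parity true a]: [a] is odd. *)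
Definition has_parity (A : zmodType) q (b : bool) (a : grassmann A q) : Prop :=
  forall K : {set 'I_q}, odd #|K| != b -> a K = 0.

Record klindex (k l m n : nat) := KLIndex {
  even_cols : {set 'I_m};
  odd_cols : {set 'I_n};
  card_even_cols : #|even_cols| = k;
  card_odd_cols : #|odd_cols| = l }.

Section Index.
Variables k l m n : nat.
Implicit Types IR : klindex k l m n.

Definition cols IR : {set 'I_(m + n)} :=
  (@lshift m n @: even_cols IR) :|: (@rshift m n @: odd_cols IR).

Lemma card_cols IR : #|cols IR| = (k + l)%N.
Proof.
rewrite cardsU !card_imset; [|exact: rshift_inj|exact: lshift_inj].
rewrite card_even_cols card_odd_cols.
rewrite (_ : _ :&: _ = set0) ?cards0 ?subn0 //; apply/setP => x; rewrite !inE.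
apply/negbTE/negP => /andP[/imsetP[i _ ->] /imsetP[j _ /eqP]].
by rewrite eq_lrshift.
Qed.

(* [enum_val] lists the elements of a set of ordinals in increasing order. *)
Definition sel_col IR (r : 'I_(k + l)) : 'I_(m + n) :=
  enum_val (cast_ord (esym (card_cols IR)) r).

Definition Mcols IR (A : Type) (Y : 'M[A]_(k + l, m + n)) : 'M[A]_(k + l) :=
  colsub (sel_col IR) Y.

Definition Dcols IR (A : Type) (Y : 'M[A]_(k + l, m + n)) :
    'M[A]_(k + l, #|~: cols IR|) :=
  colsub (fun j => enum_val j) Y.

Definition even_block (r : 'I_(k + l)) (c : 'I_(m + n)) : bool :=
  (r < k)%N == (c < m)%N.

(* The positions (row, column) to be filled with free generators: those in the
   even blocks for [b = true], those in the odd blocks for [b = false].  The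
   i-th generator goes to the i-th position of the list. *)
Definition free_pos IR (b : bool) : seq ('I_(k + l) * 'I_(m + n)) :=
  [seq rc <- [seq (r, c) | c <- enum (~: cols IR), r <- enum 'I_(k + l)]
     | even_block rc.1 rc.2 == b].

Definition alpha : nat := (k * (m - k) + l * (n - l))%N.
Definition beta : nat := (l * (m - k) + k * (n - l))%N.

Lemma lshift_cols IR i : (lshift n i \in cols IR) = (i \in even_cols IR).
Proof.
rewrite inE mem_imset; last exact: lshift_inj.
case: (i \in _) => //=; apply/negbTE/negP => /imsetP[j _ /eqP].
by rewrite eq_lrshift.
Qed.

Lemma rshift_cols IR j : (rshift m j \in cols IR) = (j \in odd_cols IR).
Proof.
rewrite inE orbC mem_imset; last exact: rshift_inj.
case: (j \in _) => //=; apply/negbTE/negP => /imsetP[i _ /eqP].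
by rewrite eq_rlshift.
Qed.

Lemma size_free_pos IR b : size (free_pos IR b) = if b then alpha else beta.
Proof.
have rows c : (\sum_(r < k + l) (even_block r c == b) =
    if (c < m)%N == b then k else l)%N.
  have evl i : even_block (lshift l i) c = (c < m)%N.
    by rewrite /even_block /= ltn_ord; case: (c < m)%N.
  have evr j : even_block (rshift k j) c = ~~ (c < m)%N.
    by rewrite /even_block /= ltnNge leq_addr; case: (c < m)%N.
  rewrite big_split_ord /=.
  under eq_bigr do rewrite evl.
  under [X in (_ + X)%N]eq_bigr do rewrite evr.
  by rewrite !sum_nat_const !card_ord; case: (c < m)%N b => [] [] /=;
    rewrite ?muln1 ?muln0 ?addn0.
have -> : size (free_pos IR b) =
    (\sum_(c in ~: cols IR) if (c < m)%N == b then k else l)%N.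
  rewrite size_filter -sum1_count big_mkcond big_allpairs_dep /= big_enum /=.
  apply: eq_bigr => c _; rewrite -rows big_enum /=.
  by apply: eq_bigr => r _; case: (_ == b).
rewrite big_mkcond big_split_ord /=.
under eq_bigr => i _ do rewrite inE lshift_cols ltn_ord.
under [X in (_ + X)%N]eq_bigr => j _ do rewrite inE rshift_cols ltnNge leq_addr.
rewrite -!big_mkcond /= !sum_nat_const.
have -> : #|[pred i | i \notin even_cols IR]| = (m - k)%N.
  rewrite -[RHS](_ : #|~: even_cols IR| = _); first by apply: eq_card => i; rewrite !inE.
  by have := cardsC (even_cols IR); rewrite card_even_cols card_ord; lia.
have -> : #|[pred i | i \notin odd_cols IR]| = (n - l)%N.
  rewrite -[RHS](_ : #|~: odd_cols IR| = _); first by apply: eq_card => i; rewrite !inE.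
  by have := cardsC (odd_cols IR); rewrite card_odd_cols card_ord; lia.
by case: b {rows}; rewrite /alpha /beta /=; lia.
Qed.

End Index.

From mathcomp Require Import all_classical all_reals all_analysis.
Import numFieldNormedType.Exports.
Local Open Scope classical_set_scope.

Record opens (R : realType) (p : nat) := Opens {
  opens_set :> set 'rV[R]_p;
  opensP : open opens_set }.

Arguments opensP {R p} o.

Section NearDiff.
Variables (R : numFieldType) (V W : normedModType R).

Lemma near0_differentiable (h : V -> W) (x : V) :
  (\forall y \near x, h y = 0) -> differentiable h x.
Proof.
move=> h0; have hx : h x = 0 by exact: nbhs_singleton h0.
have E : h \o shift x = cst (h x) + (0 : V -> W) +o_ 0 id.
  apply/eqaddoP => e e0.
  have : \forall y \near (0 : V), h (y + x) = 0.
    rewrite (near_shift x 0) /=; apply: filterS h0 => y hy.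
    by rewrite /= sub0r subrK.
  apply: filterS => y hy; rewrite hx !fctE /= hy.
  by rewrite addr0 subrr normr0 mulr_ge0 // ltW.
have c0 : continuous (\0 : V -> W) by move=> y; exact: cvg_cst.
by apply/diff_locallyP; rewrite (diff_unique c0 E).
Qed.

Lemma near_eq_differentiable (f g : V -> W) (x : V) :
  (\forall y \near x, f y = g y) -> differentiable f x -> differentiable g x.
Proof.
move=> fg df; rewrite (_ : g = f + (g - f)); last first.
  by apply/funext => y; rewrite !fctE addrC subrK.
apply: differentiableD => //; apply: near0_differentiable.
by near=> y; rewrite !fctE (near fg y) ?subrr.
Unshelve. all: by end_near. Qed.

End NearDiff.

Section Smooth.
Variables (R : realType) (p : nat).
Implicit Types (U : set 'rV[R]_p) (f g : 'rV[R]_p -> R) (k : nat).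

Definition opensI (U V : opens R p) : opens R p :=
  Opens (openI (opensP U) (opensP V)).

(* f is of class C^k on the open set U; its values outside U are irrelevant. *)
Fixpoint Ck U k f : Prop :=
  if k is k'.+1 then
    (forall x, U x -> differentiable f x) /\
    (forall i : 'I_p, Ck U k' (fun x => 'D_(delta_mx 0 i) f x))
  else forall x, U x -> {for x, continuous f}.

Definition smooth_on U f : Prop := forall k, Ck U k f.

Lemma near_open U x (P : 'rV[R]_p -> Prop) : open U -> U x ->
  (forall y, U y -> P y) -> \forall y \near x, P y.
Proof.
by move=> oU Ux UP; apply: (filterS UP); exact: (open_nbhs_nbhs (conj oU Ux)).
Qed.

Lemma Ck_ext U k f g : open U -> (forall x, U x -> f x = g x) ->
  Ck U k f -> Ck U k g.
Proof.
move=> oU; elim: k f g => [|k IH] f g fg.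
  move=> cf x Ux; rewrite /prop_for /continuous_at -(fg x Ux).
  apply: cvg_trans (cf x Ux); apply: (@near_eq_cvg _ _ (nbhs x)).
  exact: near_open oU Ux fg.
move=> [df Df]; split=> [x Ux|i].
  by apply: near_eq_differentiable (df x Ux); exact: near_open oU Ux fg.
apply: IH (Df i) => x Ux.
exact: (near_eq_derive _ (near_open oU Ux fg)).
Qed.

Lemma Ck_sub U V k f : V `<=` U -> Ck U k f -> Ck V k f.
Proof.
move=> VU; elim: k f => [|k IH] f; first by move=> h x /VU; exact: h.
by move=> [df Df]; split=> [x /VU|i]; [exact: df|exact: IH (Df i)].
Qed.

Lemma CkW U k f : Ck U k.+1 f -> Ck U k f.
Proof.
elim: k f => [|k IH] f [df Df].
  by move=> x Ux; apply: differentiable_continuous; exact: df.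
by split=> // i; exact: IH (Df i).
Qed.

Lemma Ck_cst U k (c : R) : Ck U k (cst c).
Proof.
elim: k c => [|k IH] c /=; first by move=> x _; exact: cst_continuous.
split=> // i; rewrite (_ : (fun x => _) = cst 0) //.
by apply/funext => x; rewrite derive_cst.
Qed.

Lemma CkD U k f g : open U -> Ck U k f -> Ck U k g -> Ck U k (f + g).
Proof.
move=> oU; elim: k f g => [|k IH] f g.
  by move=> cf cg x Ux; exact: continuousD (cf x Ux) (cg x Ux).
move=> [df Df] [dg Dg]; split=> [x Ux|i].
  by apply: differentiableD; [exact: df|exact: dg].
apply: Ck_ext (IH _ _ (Df i) (Dg i)) => // x Ux.
by rewrite deriveD //; apply: diff_derivable; [exact: df|exact: dg].
Qed.

Lemma CkM U k f g : open U -> Ck U k f -> Ck U k g -> Ck U k (f * g).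
Proof.
move=> oU; elim: k f g => [|k IH] f g.
  by move=> cf cg x Ux; exact: continuousM (cf x Ux) (cg x Ux).
move=> cf cg; have [cf' cg'] := (CkW cf, CkW cg).
case: cf cg => [df Df] [dg Dg]; split=> [x Ux|i].
  by apply: differentiableM; [exact: df|exact: dg].
apply: Ck_ext (CkD oU (IH _ _ cf' (Dg i)) (IH _ _ cg' (Df i))) => // x Ux.
by rewrite deriveM //; apply: diff_derivable; [exact: df|exact: dg].
Qed.

Lemma Ck_coord U k (i : 'I_p) : Ck U k (fun x => x 0 i).
Proof.
case: k => [|k] /=; first by move=> x _; exact: coord_continuous.
split=> [x _|j]; first exact: differentiable_coord.
have lf : linear (fun x : 'rV[R]_p => x 0 i).
  by move=> a u v; rewrite !mxE.
pose f : {linear 'rV[R]_p -> R} := HB.pack (fun x : 'rV[R]_p => x 0 i)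
  (GRing.isLinear.Build _ _ _ _ _ lf).
rewrite (_ : (fun x => _) = cst ((delta_mx 0 j : 'rV[R]_p) 0 i)); first exact: Ck_cst.
apply/funext => x; rewrite deriveE; last exact: differentiable_coord.
by rewrite (@diff_lin _ _ _ f) //; exact: coord_continuous.
Qed.

End Smooth.

(* [Cinf U] is C^oo(U); its elements are functions on the subtype U, smoothness
   being tested on an arbitrary extension to the ambient space. *)
Section SmoothFun.
Variables (R : realType) (p : nat) (U : opens R p).

Definition smooth_pred : {pred set_type U -> R} :=
  [pred f : set_type U -> R |
    `[< exists2 g : 'rV[R]_p -> R, smooth_on U g & f = g \o set_val >]].

Record Cinf := MkCinf {
  Cinf_fun :> set_type U -> R;
  Cinf_smooth : Cinf_fun \in smooth_pred }.

HB.instance Definition _ := [isSub for Cinf_fun].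
HB.instance Definition _ := [Choice of Cinf by <:].

Lemma smooth_predP (f : set_type U -> R) :
  reflect (exists2 g : 'rV[R]_p -> R, smooth_on U g & f = g \o set_val)
          (f \in smooth_pred).
Proof. by apply: (iffP idP) => [/asboolP|h]; last exact/asboolP. Qed.

Lemma smooth_pred_cst (c : R) : cst c \in smooth_pred.
Proof. by apply/smooth_predP; exists (cst c) => // k; exact: Ck_cst. Qed.

Lemma smooth_predD f g :
  f \in smooth_pred -> g \in smooth_pred -> f + g \in smooth_pred.
Proof.
move=> /smooth_predP[f' sf ->] /smooth_predP[g' sg ->]; apply/smooth_predP.
by exists (f' + g') => // k; apply: CkD => //; exact: opensP.
Qed.

Lemma smooth_predM f g :
  f \in smooth_pred -> g \in smooth_pred -> f * g \in smooth_pred.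
Proof.
move=> /smooth_predP[f' sf ->] /smooth_predP[g' sg ->]; apply/smooth_predP.
by exists (f' * g') => // k; apply: CkM => //; exact: opensP.
Qed.

Lemma smooth_subring : subring_closed smooth_pred.
Proof.
split=> [|f g sf sg|f g sf sg]; first exact: smooth_pred_cst.
  apply: smooth_predD => //; rewrite -mulN1r; apply: smooth_predM => //.
  exact: (smooth_pred_cst (- 1)).
exact: smooth_predM.
Qed.

HB.instance Definition _ :=
  GRing.SubChoice_isSubComPzRing.Build _ _ Cinf smooth_subring.

Lemma smooth_scaler : GRing.scaler_closed (smooth_pred : {pred set_type U -> R^o}).
Proof. by move=> c f sf; exact: (smooth_predM (smooth_pred_cst c) sf). Qed.

Definition Cinf_scale (c : R) (f : Cinf) : Cinf := MkCinf (smooth_scaler c (Cinf_smooth f)).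

Fact Cinf_scaleA a b f : Cinf_scale a (Cinf_scale b f) = Cinf_scale (a * b) f.
Proof. by apply: val_inj; exact: scalerA. Qed.
Fact Cinf_scale1 : left_id 1 Cinf_scale.
Proof. by move=> f; apply: val_inj; exact: scale1r. Qed.
Fact Cinf_scaleDr : right_distributive Cinf_scale +%R.
Proof. by move=> c f g; apply: val_inj; exact: scalerDr. Qed.
Fact Cinf_scaleDl f : {morph Cinf_scale^~ f : a b / a + b}.
Proof. by move=> a b; apply: val_inj; exact: scalerDl. Qed.

HB.instance Definition _ := GRing.Zmodule_isLmodule.Build R Cinf
  Cinf_scaleA Cinf_scale1 Cinf_scaleDr Cinf_scaleDl.

Lemma smooth_coord (i : 'I_p) : (fun x : set_type U => set_val x 0 i) \in smooth_pred.
Proof.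
by apply/smooth_predP; exists (fun x => x 0 i) => // k; exact: Ck_coord.
Qed.

Definition Cinf_coord (i : 'I_p) : Cinf := MkCinf (smooth_coord i).

End SmoothFun.

(* The sections over U of the structure sheaf of R^{p|q}. *)
Notation superfun U q := (grassmann (Cinf U) q).

Arguments smooth_pred {R p} U.

Section Restriction.
Variables (R : realType) (p : nat).
Implicit Types U V W : opens R p.

Lemma sub_set_type U V (h : V `<=` U) (x : set_type V) : set_val x \in (U : set _).
Proof. by apply/mem_set/h/set_mem; case: x. Qed.

Definition set_incl U V (h : V `<=` U) (x : set_type V) : set_type U :=
  SigSub (sub_set_type h x).

Lemma smooth_res U V (h : V `<=` U) (f : Cinf U) : f \o set_incl h \in smooth_pred V.
Proof.
case: f => f /= /smooth_predP[g sg ->]; apply/smooth_predP; exists g => //.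
by move=> k; apply: Ck_sub h (sg k).
Qed.

Definition Cinf_res U V (h : V `<=` U) (f : Cinf U) : Cinf V := MkCinf (smooth_res h f).

Definition res q U V (h : V `<=` U) (s : superfun U q) : superfun V q :=
  [ffun K => Cinf_res h (s K)].

Lemma Cinf_resB U V (h : V `<=` U) : {morph Cinf_res h : x y / x - y}.
Proof. by move=> f g; apply: val_inj. Qed.
Lemma Cinf_resM U V (h : V `<=` U) : GRing.monoid_morphism (Cinf_res h).
Proof. by split=> [|f g]; apply: val_inj. Qed.

HB.instance Definition _ U V (h : V `<=` U) :=
  GRing.isZmodMorphism.Build _ _ (Cinf_res h) (Cinf_resB h).
HB.instance Definition _ U V (h : V `<=` U) :=
  GRing.isMonoidMorphism.Build _ _ (Cinf_res h) (Cinf_resM h).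

Lemma res_is_zmod q U V (h : V `<=` U) : {morph @res q _ _ h : x y / x - y}.
Proof. by move=> s t; apply/ffunP => K; rewrite !ffunE raddfB. Qed.

Lemma res_is_monoid q U V (h : V `<=` U) : GRing.monoid_morphism (@res q _ _ h).
Proof.
split=> [|s t]; apply/ffunP => K; rewrite !ffunE ?rmorph_nat // rmorph_sum.
by apply: eq_bigr => I _; rewrite rmorphM rmorphXn rmorphN1 rmorphM !ffunE.
Qed.

HB.instance Definition _ q U V (h : V `<=` U) :=
  GRing.isZmodMorphism.Build _ _ (@res q _ _ h) (@res_is_zmod q _ _ h).
HB.instance Definition _ q U V (h : V `<=` U) :=
  GRing.isMonoidMorphism.Build _ _ (@res q _ _ h) (@res_is_monoid q _ _ h).

Lemma res_scalable q U V (h : V `<=` U) (c : R) (s : superfun U q) :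
  res h (c *: s) = c *: res h s.
Proof. by apply/ffunP => K; rewrite !ffunE; apply: val_inj. Qed.

Lemma res_parity q U V (h : V `<=` U) b (s : superfun U q) :
  has_parity b s -> has_parity b (res h s).
Proof. by move=> ps K /ps sK; rewrite ffunE sK rmorph0. Qed.

Lemma res_res q U V W (h : V `<=` U) (h' : W `<=` V) (h'' : W `<=` U)
  (s : superfun U q) : res h' (res h s) = res h'' s.
Proof.
apply/ffunP => K; rewrite !ffunE; apply/val_inj/funext => x /=.
by congr (s K _); exact: val_inj.
Qed.

Definition even_coord q U (i : 'I_p) : superfun U q :=
  [ffun K => if K == finset.set0 then Cinf_coord U i else 0].

Definition odd_coord q U (j : 'I_q) : superfun U q :=
  [ffun K => (K == finset.set1 j)%:R].

End Restriction.

(* The underlying continuous map of a morphism from U to V; only the values on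
   U matter. *)
Record cmap (R : realType) (p r : nat) (U : opens R p) (V : opens R r) := CMap {
  cmap_fun :> 'rV[R]_p -> 'rV[R]_r;
  cmap_in : forall x, opens_set U x -> opens_set V (cmap_fun x);
  cmap_cont : {within U, continuous cmap_fun} }.

Lemma preim_open (R : realType) (p r : nat) (U : opens R p) (f : 'rV[R]_p -> 'rV[R]_r)
    (W : set 'rV[R]_r) :
  {within U, continuous f} -> open W -> open (U `&` f @^-1` W).
Proof.
rewrite continuous_open_subspace; last exact: opensP.
by move=> cf oW; have [+ _] := @continuous_inP _ _ U f (opensP U); apply.
Qed.

Definition preim (R : realType) (p r : nat) (U : opens R p) (V : opens R r)
    (f : cmap U V) (W : opens R r) : opens R p :=
  Opens (preim_open (@cmap_cont _ _ _ _ _ f) (opensP W)).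

Lemma preim_sub (R : realType) (p r : nat) (U : opens R p) (V : opens R r)
    (f : cmap U V) (W W' : opens R r) :
  W' `<=` W -> preim f W' `<=` preim f W.
Proof. by move=> h x [Ux /h]. Qed.

(* Morphisms from the open subsupermanifold of R^{p|q} over U to that of
   R^{r|s} over V: a continuous map together with a morphism of sheaves of
   superalgebras O_V -> f_* O_U. *)
Record smorph (R : realType) (p q r s : nat) (U : opens R p) (V : opens R r) :=
  SMorph {
    body :> cmap U V;
    pull : forall W : opens R r, W `<=` V ->
      {rmorphism superfun W s -> superfun (preim body W) q};
    pull_scalable : forall (W : opens R r) (hW : W `<=` V) (c : R) (a : superfun W s),
      pull hW (c *: a) = c *: pull hW a;
    pull_parity : forall (W : opens R r) (hW : W `<=` V) (b : bool) (a : superfun W s),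
      has_parity b a -> has_parity b (pull hW a);
    pull_res : forall (W W' : opens R r) (hW : W `<=` V) (hW' : W' `<=` V)
        (h : W' `<=` W) (a : superfun W s),
      pull hW' (res h a) = res (preim_sub (f:=body) h) (pull hW a) }.

Section Morphisms.
Variable R : realType.

(* Equality of morphisms.  The comparison of pullbacks goes through a
   restriction map because the two preimages of W are only provably equal. *)
Definition smorph_eq (p q r s : nat) (U : opens R p) (V : opens R r)
    (f g : smorph q s U V) : Prop :=
  (forall x, opens_set U x -> f x = g x) /\
  (forall (W : opens R r) (hW : W `<=` V) (h : preim f W `<=` preim g W)
     (a : superfun W s), pull f hW a = res h (pull g hW a)).

Lemma sub_preim (p r : nat) (U : opens R p) (V : opens R r) (f : cmap U V) :
  U `<=` preim f V.
Proof. by move=> x Ux; split=> //; exact: cmap_in. Qed.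

Definition pull_global (p q r s : nat) (U : opens R p) (V : opens R r)
    (f : smorph q s U V) (a : superfun V s) : superfun U q :=
  res (@sub_preim _ _ _ _ f) (pull f (fun x (Vx : opens_set V x) => Vx) a).

(* The inclusion of an open subsupermanifold: the identity if U = V. *)
Section Inclusion.
Variables (p q : nat) (U V : opens R p) (UV : U `<=` V).

Definition incl_cmap : cmap U V.
Proof.
apply: (@CMap _ _ _ _ _ id); first exact: UV.
by apply: continuous_subspaceT => x; exact: cvg_id.
Defined.

Lemma incl_preim_sub (W : opens R p) : preim incl_cmap W `<=` W.
Proof. by move=> x []. Qed.

Definition incl_pull (W : opens R p) (hW : W `<=` V) :
    {rmorphism superfun W q -> superfun (preim incl_cmap W) q} :=
  @res R p q W (preim incl_cmap W) (@incl_preim_sub W).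

Definition incl : smorph q q U V.
Proof.
apply: (@SMorph _ _ _ _ _ _ _ incl_cmap incl_pull).
- by move=> W hW c a; exact: res_scalable.
- by move=> W hW b a; exact: res_parity.
- move=> W W' hW hW' h a /=.
  have h' : preim incl_cmap W' `<=` W by move=> x [_ /h].
  by rewrite !(res_res _ _ h').
Defined.

End Inclusion.

(* The composite "f then g", where the source V' of g and the target V of f are
   open in the same R^{r|s}; it is defined on the preimage of V' under f. *)
Section Composition.
Variables (p q r s t u : nat).
Variables (U : opens R p) (V V' : opens R r) (X : opens R t).
Variables (f : smorph q s U V) (g : smorph s u V' X).

Definition comp_dom : opens R p := preim f V'.

Definition comp_cmap : cmap comp_dom X.
Proof.
apply: (@CMap _ _ _ _ _ (g \o f)) => [x [_ /(@cmap_in _ _ _ _ _ g)] //|].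
rewrite continuous_open_subspace; last exact: opensP.
move=> x /set_mem[Ux V'fx]; apply: continuous_comp.
  have := @cmap_cont _ _ _ _ _ f; rewrite continuous_open_subspace; last exact: opensP.
  by apply; exact: mem_set.
have := @cmap_cont _ _ _ _ _ g; rewrite continuous_open_subspace; last exact: opensP.
by apply; exact: mem_set.
Defined.

Lemma comp_subl (W : opens R t) : opensI V (preim g W) `<=` preim g W.
Proof. by move=> x []. Qed.

Lemma comp_subr (W : opens R t) : opensI V (preim g W) `<=` V.
Proof. by move=> x []. Qed.

Lemma comp_preim (W : opens R t) :
  preim comp_cmap W `<=` preim f (opensI V (preim g W)).
Proof.
by move=> x [[Ux V'fx] Wx]; split=> //; split; [exact: cmap_in|split].
Qed.

Definition comp_pull (W : opens R t) (hW : W `<=` X) :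
    {rmorphism superfun W u -> superfun (preim comp_cmap W) q} :=
  @res R p q _ _ (@comp_preim W) \o
    (pull f (@comp_subr W) \o (@res R r s _ _ (@comp_subl W) \o pull g hW)).

Definition smorph_comp : smorph q u comp_dom X.
Proof.
apply: (@SMorph _ _ _ _ _ _ _ comp_cmap comp_pull).
- by move=> W hW c a; rewrite /= pull_scalable res_scalable pull_scalable res_scalable.
- by move=> W hW b a pa; do 2 (apply: res_parity; apply: pull_parity).
- move=> W W' hW hW' h a /=; rewrite (pull_res g hW hW' h).
  have h1 : opensI V (preim g W') `<=` opensI V (preim g W).
    by move=> x [Vx [V'x /h]].
  have h2 : opensI V (preim g W') `<=` preim g W by move=> x [_ [V'x /h]].
  rewrite (res_res _ _ h2) -(res_res (@comp_subl W) h1 h2) (pull_res f (@comp_subr W) _ h1).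
  have h3 : preim comp_cmap W' `<=` preim f (opensI V (preim g W)).
    by move=> x [[Ux V'fx] /h Wx]; split=> //; split; [exact: cmap_in|split].
  by rewrite !(res_res _ _ h3).
Defined.

End Composition.

(* The composites below are defined on open subsupermanifolds which are equal to
   their targets only up to proof, or smaller: being the identity there means
   being equal to the inclusion. *)
Definition is_identity (p q : nat) (U V : opens R p) (f : smorph q q U V) : Prop :=
  exists UV : U `<=` V, smorph_eq f (incl q UV).

End Morphisms.

Section Charts.
Variables (R : realType) (k l m n : nat).
Notation p := (alpha k l m n).
Notation q := (beta k l m n).
Implicit Types (IR JS : klindex k l m n) (W : opens R p).

(* The number [i] stays below alpha, resp. beta, whenever it is used: see
   [size_free_pos]. *)
Definition even_gen W (i : nat) : superfun W q :=
  if insub i is Some i' then even_coord q W i' else 0.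
Definition odd_gen W (j : nat) : superfun W q :=
  if insub j is Some j' then odd_coord W j' else 0.

(* The matrix A_{I|R}, with entries restricted to W. *)
Definition Amx IR W : 'M[superfun W q]_(k + l, m + n) :=
  \matrix_(r, c)
    if c \in cols IR then (c == sel_col IR r)%:R
    else if even_block r c then even_gen W (index (r, c) (free_pos IR true))
    else odd_gen W (index (r, c) (free_pos IR false)).

Definition is_inverse (A : pzRingType) (d : nat) (M N : 'M[A]_d) : Prop :=
  M *m N = 1%:M /\ N *m M = 1%:M.

(* The largest open subset on which M_{J|S}(A_{I|R}) is invertible. *)
Definition overlap_set IR JS : set 'rV[R]_p :=
  [set x | exists W : opens R p, opens_set W x /\
     exists N, is_inverse (Mcols JS (Amx IR W)) N].

Lemma overlap_open IR JS : open (overlap_set IR JS).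
Proof.
rewrite openE => x [W [Wx invW]]; rewrite /interior.
apply: filterS (open_nbhs_nbhs (conj (opensP W) Wx)) => y Wy.
by exists W.
Qed.

Definition overlap IR JS : opens R p := Opens (@overlap_open IR JS).

(* [g] is g_{I|R,J|S}; [N] is the inverse of M_{J|S}(A_{I|R}). *)
Definition is_transition IR JS (g : smorph q q (overlap IR JS) (overlap JS IR)) : Prop :=
  exists2 N : 'M[superfun (overlap IR JS) q]_(k + l),
    is_inverse (Mcols JS (Amx IR (overlap IR JS))) N &
    map_mx (pull_global g) (Dcols JS (Amx JS (overlap JS IR))) =
      Dcols JS (N *m Amx IR (overlap IR JS)).

Lemma Mcols_Amx IR W : Mcols IR (Amx IR W) = 1%:M.
Proof.
apply/matrixP => r c; rewrite !mxE enum_valP.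
by rewrite /sel_col (inj_eq enum_val_inj) (inj_eq (@cast_ord_inj _ _ _)) eq_sym.
Qed.

Lemma overlap_refl IR : overlap_set IR IR = setT.
Proof.
apply/seteqP; split=> // x _; exists (Opens openT); split=> //.
by exists 1%:M; rewrite Mcols_Amx; split; rewrite mulmx1.
Qed.

End Charts.

(* Main.v *)
(* Write A_I for the matrix labelling the chart of the index I.  By definition the morphism
   g_{I,J} pulls A_J back to N A_I, where N is the inverse of M_J(A_I): the columns outside J are
   the definition, and in the columns of J both matrices are the identity.  Hence any composite of
   transition morphisms that starts and ends at I pulls A_I back to Q A_I for some matrix Q, and
   comparing the columns of I gives Q = 1, so that the composite fixes all coordinates.

   A morphism h fixing the coordinates is the identity.  Its underlying map is, because
   (x_i - c) is invertible where x_i differs from c.  For the pullback of a superfunction near a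
   point a, Hadamard's lemma writes each coefficient as c + sum_i (x_i - a_i) g_i with g_i smooth;
   the pullback of (x_i - a_i) vanishes at a, whatever the pullback of g_i is. *)

Require Import Defs.
From HB Require Import structures.
From mathcomp Require Import all_boot all_order all_algebra.
From mathcomp Require Import ring.
From mathcomp Require Import all_classical all_reals all_analysis.

Set Implicit Arguments.
Unset Strict Implicit.
Unset Printing Implicit Defensive.

Import Order.TTheory GRing.Theory Num.Theory.
Import numFieldNormedType.Exports.
Local Open Scope classical_set_scope.
Local Open Scope ring_scope.

(** * Differentiation and uniform continuity along segments issuing from a fixed point *)

Section Segments.
Variables (R : realType) (p : nat).
Implicit Types (a x y h : 'rV[R]_p) (F : 'rV[R]_p -> R).

Lemma derive_coord_sum F x h : differentiable F x ->
  'D_h F x = \sum_(i < p) h 0 i * 'D_(delta_mx 0 i) F x.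
Proof.
move=> dF; rewrite deriveE // {1}(row_sum_delta h) linear_sum /=.
by apply: eq_bigr => i _; rewrite linearZ deriveE.
Qed.

Lemma is_derive_line F x h (s : R) : differentiable F (x + s *: h) ->
  is_derive s 1 (fun t : R => F (x + t *: h)) ('D_h F (x + s *: h)).
Proof.
move=> dF.
have dl : is_diff s (fun t : R => x + t *: h) ( *:%R^~ h).
  by apply: is_diff_eq => /=; rewrite add0r.
have dc : differentiable (F \o (fun t : R => x + t *: h)) s.
  exact: differentiable_comp.
apply: DeriveDef; first exact/derivable1_diffP.
rewrite deriveE // diff_comp //= deriveE //.
by rewrite (diff_val (is_diff_def := dl)) scale1r.
Qed.

Definition segment_pt a x (t : R) := a + t *: (x - a).

Lemma segment_ball a (r : R) x t : ball a r x -> 0 <= t <= 1 ->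
  ball a r (segment_pt a x t).
Proof.
rewrite -ball_normE /= /segment_pt => axr /andP[t0 t1].
rewrite opprD addNKr normrN normrZ ger0_norm // distrC.
by apply: le_lt_trans axr; rewrite ler_piMl.
Qed.

Lemma continuous_segment a (z : 'rV[R]_p * R) :
  {for z, continuous (fun z : 'rV[R]_p * R => segment_pt a z.1 z.2)}.
Proof.
apply: cvgD; first exact: cvg_cst.
apply: cvgZ; first exact: cvg_snd.
by apply: cvgB; [exact: cvg_fst|exact: cvg_cst].
Qed.

(** The estimate is uniform in [t]: the map sending [(y, t)] to [F (segment_pt a y t)] is jointly
    continuous, and [[0, 1]] is compact. *)
Lemma segment_near a (r : R) F x e : ball a r x ->
  (forall y, ball a r y -> {for y, continuous F}) -> 0 < e ->
  \forall y \near x, ball a r y /\ forall t : R, 0 <= t <= 1 ->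
    `|F (segment_pt a y t) - F (segment_pt a x t)| <= e.
Proof.
move=> Bx cF e0.
have cseg t : 0 <= t <= 1 ->
    {for (x, t), continuous (fun z : 'rV[R]_p * R => F (segment_pt a z.1 z.2))}.
  move=> t01; apply: (@continuous_comp _ _ _ (fun z => segment_pt a z.1 z.2) F).
    exact: continuous_segment.
  by apply: cF; exact: segment_ball.
have := open_nbhs_nbhs (conj (ball_open a r) Bx); apply: filterS2 => [y Py By|].
  split=> //; exact: Py.
have /compact_near_coveringP cv := @segment_compact R 0 1.
have := cv _ (nbhs x) (fun y t => `|F (segment_pt a y t) - F (segment_pt a x t)| <= e) _.
apply => t; rewrite /= in_itv /= => t01.
have e2 : 0 < e / 2 by rewrite divr_gt0.
have /cvgrPdist_lt/(_ _ e2) := cseg t t01.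
(* The values at [(y, t')] and at [(x, t')] are both within [e / 2] of the value at [(x, t)]. *)
case=> -[A B] /= [Ax Bt] AB; exists (B, A) => //= -[t' y] /= [Bt' Ay].
have h1 := AB (y, t') (conj Ay Bt').
have h2 := AB (x, t') (conj (nbhs_singleton Ax) Bt').
rewrite -(subrKA (F (segment_pt a x t))) [leRHS]splitr.
apply: le_trans (ler_normD _ _) _; apply: lerD; apply: ltW => //.
by rewrite distrC.
Qed.
End Segments.

(** * Integrals of continuous functions over the unit interval *)

Section UnitIntegral.
Variable R : realType.
Implicit Types phi psi : R -> R.
Local Notation mu := (@lebesgue_measure R).

Definition cont01 phi := {within `[0, 1], continuous phi}.
Definition int01 phi : R := Rintegral mu `[0, 1] phi.

Lemma cont01_integrable phi : cont01 phi -> mu.-integrable `[0, 1] (EFin \o phi).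
Proof. by move=> cphi; apply: continuous_compact_integrable => //; exact: segment_compact. Qed.

Lemma cont01P phi : (forall t : R, 0 <= t <= 1 -> {for t, continuous phi}) -> cont01 phi.
Proof.
by move=> h; apply: continuous_in_subspaceT => t /set_mem; rewrite /= in_itv; exact: h.
Qed.

Lemma cont01D phi psi : cont01 phi -> cont01 psi -> cont01 (fun t => phi t + psi t).
Proof. by move=> cphi cpsi t; apply: cvgD; [exact: cphi|exact: cpsi]. Qed.

Lemma cont01Z c phi : cont01 phi -> cont01 (fun t => c * phi t).
Proof. by move=> cphi t; apply: cvgM; [exact: cvg_cst|exact: cphi]. Qed.

Lemma cont01_sum p (phi : 'I_p -> R -> R) : (forall i, cont01 (phi i)) ->
  cont01 (fun t => \sum_(i < p) phi i t).
Proof.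
move=> cphi t; apply: cvg_big => [|i _]; last exact: cphi.
by apply: add_continuous.
Qed.

Lemma int01D phi psi : cont01 phi -> cont01 psi ->
  int01 (fun t => phi t + psi t) = int01 phi + int01 psi.
Proof. by move=> cphi cpsi; apply: RintegralD => //; exact: cont01_integrable. Qed.

Lemma int01Z c phi : cont01 phi -> int01 (fun t => c * phi t) = c * int01 phi.
Proof. by move=> cphi; apply: RintegralZl => //; exact: cont01_integrable. Qed.

Lemma int01_sum p (phi : 'I_p -> R -> R) : (forall i, cont01 (phi i)) ->
  int01 (fun t => \sum_(i < p) phi i t) = \sum_(i < p) int01 (phi i).
Proof.
elim: p phi => [|p IH] phi cphi.
  under eq_fun do rewrite big_ord0.
  by rewrite big_ord0 /int01 Rintegral_cst // mul0r.
under eq_fun do rewrite big_ord_recl.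
rewrite int01D ?IH ?big_ord_recl //; exact: cont01_sum.
Qed.

Lemma int01_norm_le phi (e : R) : cont01 phi ->
  (forall t : R, 0 <= t <= 1 -> `|phi t| <= e) -> `|int01 phi| <= e.
Proof.
move=> cphi le_e; apply: le_trans (le_normr_Rintegral _ _) _ => //.
  exact: cont01_integrable.
have -> : e = int01 (cst e).
  rewrite /int01 Rintegral_cst //= (lebesgue_measure_itv `[0%R, 1%R]) /= lte_fin ltr01.
  by rewrite /= oppr0 addr0 mulr1.
apply: le_Rintegral => //.
- apply: (@cont01_integrable (fun t => `|phi t|)) => t.
  by apply: cvg_norm; exact: cphi.
- by apply: (@cont01_integrable (cst e)) => t; exact: cvg_cst.
Qed.

Lemma int01_derive phi dphi : cont01 dphi ->
  (forall t : R, 0 <= t <= 1 -> is_derive t 1 phi (dphi t)) ->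
  int01 dphi = phi 1 - phi 0.
Proof.
move=> cd dd.
have cphi (t : R) : 0 <= t <= 1 -> {for t, continuous phi}.
  move=> t01; apply: differentiable_continuous; apply/derivable1_diffP.
  by have := dd t t01; case.
rewrite /int01 /Rintegral (@continuous_FTC2 _ _ phi) //.
- split.
  + move=> t; rewrite in_itv /= => /andP[/ltW t0 /ltW t1].
    by have := dd t; rewrite t0 t1; case.
  + by apply: cvg_at_right_filter; apply: cphi; rewrite lexx ler01.
  + by apply: cvg_at_left_filter; apply: cphi; rewrite lexx ler01.
- move=> t; rewrite in_itv /= => /andP[/ltW t0 /ltW t1]; rewrite derive1E.
  by have := dd t; rewrite t0 t1; case/(_ isT).
Qed.
End UnitIntegral.

(** * Differentiation under the integral sign and Hadamard's lemma *)

Lemma differentiable_near (R : realType) (V W : normedModType R) (F : V -> W) (x : V)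
    (L : {linear V -> W}) : continuous L ->
  (forall e : R, 0 < e ->
     \forall h \near (0 : V), `|F (h + x) - F x - L h| <= e * `|h|) ->
  differentiable F x /\ 'd F x = L :> (V -> W).
Proof.
move=> cL FL.
have E : F \o shift x = cst (F x) + (L : V -> W) +o_ 0 id.
  apply/eqaddoP => e e0; apply: filterS (FL e e0) => h /=.
  by rewrite !fctE /= opprD addrA.
have dL := diff_unique cL E.
by split=> //; apply/diff_locallyP; rewrite dL.
Qed.

Section RadialMean.
Variables (R : realType) (p : nat) (a : 'rV[R]_p) (r : R).
Implicit Types (x y h : 'rV[R]_p) (F : 'rV[R]_p -> R) (j : nat).
Local Notation B := (ball a r).

(** This turns a first-order estimate with prescribed candidates for the partial derivatives into
    differentiability; the candidates for a radial mean will be integrals. *)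
Lemma differentiable_sum_coords F x (d : 'I_p -> R) :
  (forall e : R, 0 < e ->
     \forall h \near (0 : 'rV[R]_p), `|F (h + x) - F x - \sum_(i < p) h 0 i * d i| <= e * `|h|) ->
  differentiable F x /\ forall i, 'D_(delta_mx 0 i) F x = d i.
Proof.
move=> Fd.
have lL : linear (fun h : 'rV[R]_p => \sum_(i < p) h 0 i * d i).
  move=> c u v; rewrite scaler_sumr -big_split /=; apply: eq_bigr => i _.
  by rewrite !mxE mulrDl -mulrA.
pose L : {linear 'rV[R]_p -> R} := HB.pack (fun h : 'rV[R]_p => \sum_(i < p) h 0 i * d i)
  (GRing.isLinear.Build _ _ _ _ _ lL).
have cL : continuous L.
  move=> h; apply: (@cvg_big _ _ _ _ xpredT add_continuous _ (nbhs h)) => i _.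
  by apply: (@continuousM _ _ (fun h : 'rV[R]_p => h 0 i) (cst (d i)));
    [exact: coord_continuous|exact: cst_continuous].
have [dF dL] : differentiable F x /\ 'd F x = L :> ('rV[R]_p -> R).
  by apply: differentiable_near.
split=> // i; rewrite deriveE // dL /= (bigD1 i) //= mxE !eqxx mul1r.
by rewrite big1 ?addr0 // => i' /negPf ni; rewrite mxE ni andbF mul0r.
Qed.

(** Hadamard's coefficients are the means with [j = 0] of the partial derivatives. Each
    differentiation in [x] brings out a factor [t], so the weight [t ^+ j] makes the family closed
    under differentiation. *)
Definition radial_mean j F x : R := int01 (fun t => t ^+ j * F (segment_pt a x t)).

Lemma cont01_radial j F x : B x -> (forall y, B y -> {for y, continuous F}) ->
  cont01 (fun t => t ^+ j * F (segment_pt a x t)).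
Proof.
move=> Bx cF; apply: cont01P => t t01; apply: cvgM; first exact: exprn_continuous.
have cs : {for t, continuous (segment_pt a x)}.
  by apply: cvgD; [exact: cvg_cst|apply: cvgZ; [exact: cvg_id|exact: cvg_cst]].
by apply: (continuous_comp cs); apply: cF; exact: segment_ball.
Qed.

Lemma radial_mean_continuous j F x : B x ->
  (forall y, B y -> {for y, continuous F}) -> {for x, continuous (radial_mean j F)}.
Proof.
move=> Bx cF; apply/(@cvgrPdist_le _ _ _ (nbhs x)) => e e0.
apply: (@filterS _ (nbhs x) _ _ _ _ (segment_near Bx cF e0)) => y [By Fy].
rewrite distrC /radial_mean -mulN1r -int01Z; last exact: cont01_radial.
rewrite -int01D; [|exact: cont01_radial|by apply: cont01Z; exact: cont01_radial].
apply: int01_norm_le.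
  by apply: cont01D; [|apply: cont01Z]; exact: cont01_radial.
move=> t t01; rewrite mulN1r -mulrBr normrM; have := Fy t t01.
case/andP: t01 => t0 t1; apply: le_trans.
by rewrite ler_piMl // normrX ger0_norm // exprn_ile1.
Qed.

(** For fixed [t], the mean value theorem expresses the increment of [F] through its partial
    derivatives at an intermediate point. These are uniformly close in [t] to those on the segment
    to [x], which bounds the integral of the error. *)
Lemma radial_mean_differentiable j F x : B x ->
  (forall y, B y -> differentiable F y) ->
  (forall i y, B y -> {for y, continuous (fun z => 'D_(delta_mx 0 i) F z)}) ->
  differentiable (radial_mean j F) x /\
  forall i, 'D_(delta_mx 0 i) (radial_mean j F) x =
    radial_mean j.+1 (fun z => 'D_(delta_mx 0 i) F z) x.
Proof.
move=> Bx dF cD; apply: differentiable_sum_coords => e e0.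
have cF y : B y -> {for y, continuous F}.
  by move=> By; apply: differentiable_continuous; exact: dF.
pose D i z := 'D_(delta_mx 0 i) F z.
(* Each of the [p] coordinates will contribute at most [e' * |h|]. Dividing by [p.+1] also covers
   [p = 0]. *)
pose e' := e / p.+1%:R.
have e'0 : 0 < e' by rewrite divr_gt0.
have nearD : \forall y \near x, forall i : 'I_p, forall t : R, 0 <= t <= 1 ->
    `|D i (segment_pt a y t) - D i (segment_pt a x t)| <= e'.
  apply: (@filter_forall _ _ (fun (i : 'I_p) y => forall t : R, 0 <= t <= 1 ->
    `|D i (segment_pt a y t) - D i (segment_pt a x t)| <= e') (nbhs x)) => i.
  by apply: (@filterS _ (nbhs x) _ _ _ _ (segment_near Bx (cD i) e'0)) => y [].
have nearB : \forall y \near x, B y by exact: open_nbhs_nbhs (conj (ball_open a r) Bx).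
have [d /= d0 xd] := (proj1 (nbhs_ballP _ _) (filterI nearB nearD)).
apply: (@filterS _ (nbhs (0 : 'rV[R]_p)) _ _ _ _ (nbhsx_ballx _ d d0)) => h.
rewrite -ball_normE /= sub0r normrN => hd.
have hB s : 0 <= s <= 1 -> ball x d (x + s *: h).
  move=> /andP[s0 s1]; rewrite -ball_normE /= opprD addNKr normrN normrZ ger0_norm //.
  by apply: le_lt_trans hd; rewrite ler_piMl.
have Bh : B (h + x) by have [] := xd (x + 1 *: h) (hB 1 _); rewrite ?lexx ?ler01 // scale1r addrC.
have cDi i : cont01 (fun t => h 0 i * (t ^+ j.+1 * D i (segment_pt a x t))).
  by apply: cont01Z; apply: cont01_radial => // y; exact: cD.
have cN : cont01 (fun t =>
    t ^+ j * F (segment_pt a (h + x) t) + -1 * (t ^+ j * F (segment_pt a x t))).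
  by apply: cont01D; [|apply: cont01Z]; exact: cont01_radial.
(* The whole error becomes one integral, to be bounded pointwise in [t]. *)
have -> : radial_mean j F (h + x) - radial_mean j F x -
    \sum_(i < p) h 0 i * radial_mean j.+1 (D i) x =
  int01 (fun t => (t ^+ j * F (segment_pt a (h + x) t) + -1 * (t ^+ j * F (segment_pt a x t)))
    + -1 * \sum_(i < p) h 0 i * (t ^+ j.+1 * D i (segment_pt a x t))).
  rewrite int01D //; last by apply: cont01Z; exact: cont01_sum.
  rewrite int01D; [|exact: cont01_radial|by apply: cont01Z; exact: cont01_radial].
  rewrite !int01Z; [|exact: cont01_sum|exact: cont01_radial].
  rewrite int01_sum // !mulN1r; congr (_ - _); apply: eq_bigr => i _.
  by rewrite int01Z //; apply: cont01_radial => // y; exact: cD.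
apply: int01_norm_le.
  by apply: cont01D => //; apply: cont01Z; exact: cont01_sum.
move=> t /[dup] t01 /andP[t0 t1].
(* Moving the endpoint by [s *: h] moves the point at parameter [t] only by [t] times as much: this
   is the source of the extra factor [t]. *)
have segE s : segment_pt a (x + s *: h) t = segment_pt a x t + s *: (t *: h).
  by rewrite /segment_pt addrAC scalerDr addrA scalerA mulrC -scalerA.
have := @MVT_segment R (fun s : R => F (segment_pt a x t + s *: (t *: h)))
  (fun s => 'D_(t *: h) F (segment_pt a x t + s *: (t *: h))) 0 1 ler01.
case=> [s||c].
- rewrite in_itv /= => /andP[/ltW s0 /ltW s1]; apply: is_derive_line.
  rewrite -segE; apply: dF; apply: segment_ball => //.
  by have [] := xd _ (hB s _); rewrite ?s0.
- apply: cont01P => s s01; apply: differentiable_continuous; apply/derivable1_diffP.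
  have : differentiable F (segment_pt a x t + s *: (t *: h)).
    rewrite -segE; apply: dF; apply: segment_ball => //.
    by have [] := xd _ (hB s s01).
  by move/is_derive_line; case.
rewrite in_itv /= => c01; rewrite scale0r addr0 scale1r subr0 mulr1 => FE.
have [Bc Dc] := xd _ (hB c c01).
have -> : segment_pt a (h + x) t = segment_pt a x t + t *: h.
  by have := segE 1; rewrite !scale1r addrC.
rewrite !mulN1r -mulrBr FE derive_coord_sum; last first.
  by rewrite -segE; apply: dF; exact: segment_ball.
rewrite mulr_sumr -sumrB.
apply: le_trans (ler_norm_sum _ _ _) _.
apply: le_trans (_ : \sum_(i < p) e' * `|h| <= _); last first.
  rewrite sumr_const card_ord -mulr_natl mulrA ler_wpM2r //.
  rewrite /e' mulrCA ler_piMr ?(ltW e0) //.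
  by rewrite ler_pdivrMr // mul1r ler_nat.
apply: ler_sum => i _.
rewrite mxE -segE.
have -> : t ^+ j * (t * h 0 i * D i (segment_pt a (x + c *: h) t)) -
    h 0 i * (t ^+ j.+1 * D i (segment_pt a x t)) =
    t ^+ j.+1 * (h 0 i * (D i (segment_pt a (x + c *: h) t) - D i (segment_pt a x t))).
  by rewrite exprS; ring.
rewrite !normrM -[leRHS]mul1r ler_pM //.
  by rewrite normrX ger0_norm // exprn_ile1.
rewrite mulrC ler_pM //; first exact: Dc.
(* The norm of a row vector is the largest absolute value of its entries. *)
rewrite -[X in _ <= X]/(mx_norm h) mx_normrE.
exact: (le_bigmax _ (fun ij => `|h ij.1 ij.2|) (0, i)).
Qed.

(** Induction on [k] for all [j] at once, since a partial derivative of the mean of weight [j] is a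
    mean of weight [j.+1]. *)
Lemma radial_mean_Ck k j F : Ck B k F -> Ck B k (radial_mean j F).
Proof.
elim: k j F => [|k IH] j F.
  by move=> cF x Bx; exact: radial_mean_continuous.
move=> CF; have [dF DF] := CF.
have dG x (Bx : B x) := @radial_mean_differentiable j F x Bx dF _.
have cD i y : B y -> {for y, continuous (fun z => 'D_(delta_mx 0 i) F z)}.
  move=> By; have : Ck B 0 (fun z => 'D_(delta_mx 0 i) F z).
    by elim: k {IH dF CF dG} DF => [|k IH] DF; [exact: DF|apply: IH => i'; exact: CkW (DF i')].
  exact.
split=> [x Bx|i]; first by have [] := dG cD x Bx.
apply: Ck_ext (IH j.+1 _ (DF i)); first exact: ball_open.
by move=> x Bx; have [_ ->] := dG cD x Bx.
Qed.

(** The difference [F x - F a] is the integral over [[0, 1]] of the derivative of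
    [F (a + t *: (x - a))] in [t], which the chain rule expands in the coordinates of [x - a]. *)
Lemma hadamard F : smooth_on B F -> exists2 G : 'I_p -> 'rV[R]_p -> R,
  forall i, smooth_on B (G i) &
  forall x, B x -> F x = F a + \sum_(i < p) (x 0 i - a 0 i) * G i x.
Proof.
move=> sF; exists (fun i => radial_mean 0 (fun z => 'D_(delta_mx 0 i) F z)).
  by move=> i k; apply: radial_mean_Ck; have [_] := sF k.+1; exact.
move=> x Bx; have [dF _] := sF 1%N.
have cD i y : B y -> {for y, continuous (fun z => 'D_(delta_mx 0 i) F z)}.
  by have [_ /(_ i)] := sF 1%N; exact.
have cP i : cont01 (fun t => (x 0 i - a 0 i) * (t ^+ 0 * 'D_(delta_mx 0 i) F (segment_pt a x t))).
  by apply: cont01Z; apply: (@cont01_radial _ (fun z => 'D_(delta_mx 0 i) F z)) => // y; exact: cD.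
have -> : \sum_(i < p) (x 0 i - a 0 i) * radial_mean 0 (fun z => 'D_(delta_mx 0 i) F z) x =
  int01 (fun t => \sum_(i < p) (x 0 i - a 0 i) * (t ^+ 0 * 'D_(delta_mx 0 i) F (segment_pt a x t))).
  rewrite int01_sum //; apply: eq_bigr => i _.
  rewrite int01Z //.
  by apply: (@cont01_radial _ (fun z => 'D_(delta_mx 0 i) F z)) => // y; exact: cD.
have segE : F x = F a + (F (segment_pt a x 1) - F (segment_pt a x 0)).
  by rewrite /segment_pt scale1r scale0r addr0 !subrKC.
rewrite segE; congr (_ + _); apply/esym.
apply: (@int01_derive R (fun t => F (segment_pt a x t))); first exact: cont01_sum.
move=> t t01; have dFt : differentiable F (a + t *: (x - a)).
  by apply: dF; exact: segment_ball.
have -> : \sum_(i < p) (x 0 i - a 0 i) * (t ^+ 0 * 'D_(delta_mx 0 i) F (segment_pt a x t)) =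
    'D_(x - a) F (a + t *: (x - a)).
  by rewrite derive_coord_sum //; apply: eq_bigr => i _; rewrite !mxE expr0 mul1r.
exact: is_derive_line.
Qed.
End RadialMean.

(** * Constants and monomials in a Grassmann algebra *)

Section Grassmann.
Variables (A : comPzRingType) (q : nat).
Implicit Types (f g : A) (s : grassmann A q) (I J K L : {set 'I_q}).

Definition gr_const f : grassmann A q := [ffun K => if K == finset.set0 then f else 0].

Definition gr_mono K : grassmann A q := [ffun L => (L == K)%:R].

Lemma gr_sumE (T : finType) (P : pred T) (F : T -> grassmann A q) K :
  (\sum_(i | P i) F i) K = \sum_(i | P i) F i K.
Proof.
by apply: (big_morph (fun s => s K)) => [s t|]; rewrite ffunE.
Qed.

Lemma gr_const_mulE f s K : (gr_const f * s) K = f * s K.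
Proof.
rewrite ffunE (bigD1 finset.set0) ?finset.sub0set //= big1 => [|I /andP[_ /negPf I0]].
  by rewrite gr_inv0l ffunE eqxx mul1r addr0 finset.setD0.
by rewrite ffunE I0 mul0r mulr0.
Qed.

(** Moving theta_j to the end of theta_K costs the sign counted by [gr_inv], which is its own
    inverse. This reduces monomials to single generators by induction. *)
Lemma gr_mono_setD1 K j : j \in K ->
  gr_mono K = (-1) ^+ gr_inv (K :\ j)%SET (finset.set1 j) *
    (gr_mono (K :\ j)%SET * gr_mono (finset.set1 j)).
Proof.
move=> jK; apply/ffunP => L.
have signE (b : bool) s : ((-1) ^+ b * s) L = (-1) ^+ b * s L.
  by case: b; rewrite /= ?expr1 ?expr0 ?mul1r // !mulN1r ffunE.
rewrite -signr_odd signE signr_odd !ffunE.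
case: eqP => [->|LK].
  rewrite (bigD1 (K :\ j)%SET) ?subD1set //= big1 => [|I /andP[_ /negPf IK]].
    rewrite !ffunE eqxx (_ : K :\: (K :\ j) = finset.set1 j)%SET.
      by rewrite eqxx !mulr1 addr0 -expr2 sqrr_sign.
    apply/setP => i; rewrite !inE; case: (eqVneq i j) => [->|_] /=; [exact: jK|exact: andNb].
  by rewrite !ffunE IK mul0r mulr0.
(* A nonzero term would have [I] equal to [K] without [j] and [L] without [I] equal to the singleton
   of [j], forcing [L = K]. *)
rewrite big1 ?mulr0 // => I IL; rewrite !ffunE.
case: eqP => [IE|]; last by rewrite mul0r mulr0.
case: eqP => [LE|]; last by rewrite !mulr0.
case: LK; rewrite -(finset.setID L I) LE IE; apply/setP => i.
have := fintype.subsetP IL i; rewrite IE !inE.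
case: (eqVneq i j) => [->|ij] /=; first by rewrite jK orbT.
by case: (i \in K) => /= [->|] //; rewrite andbF.
Qed.

Lemma gr_decomp s : s = \sum_K gr_const (s K) * gr_mono K.
Proof.
apply/ffunP => L; rewrite gr_sumE (bigD1 L) //= big1 => [|K /negPf KL].
  by rewrite gr_const_mulE ffunE eqxx mulr1 addr0.
by rewrite gr_const_mulE ffunE eq_sym KL mulr0.
Qed.

End Grassmann.

Lemma gr_one_neq0 (A : comNzRingType) q : (1 : grassmann A q) <> 0.
Proof.
move/(congr1 (fun s : grassmann A q => s finset.set0)); rewrite !ffunE eqxx /=.
by move/eqP; rewrite oner_eq0.
Qed.

(** * Values of superfunctions at points *)

Section Evaluation.
Variables (R : realType) (p q : nat) (U : opens R p).
Implicit Types (x : set_type U) (s : superfun U q).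

(** Only the coefficients are evaluated and the odd generators are kept, so that the values
    determine the superfunction. *)
Definition gr_eval x s : grassmann R q := [ffun K => s K x].

Lemma gr_eval_zmod x : {morph gr_eval x : s t / s - t}.
Proof. by move=> s t; apply/ffunP => K; rewrite !ffunE. Qed.

Lemma Cinf_sumE x (T : finType) (P : pred T) (F : T -> Cinf U) :
  (\sum_(i | P i) F i) x = \sum_(i | P i) F i x.
Proof. by apply: (big_morph (fun f : Cinf U => f x)). Qed.

Lemma Cinf_signE x n (f : Cinf U) : ((-1) ^+ n * f) x = (-1) ^+ n * f x.
Proof. by rewrite -!(signr_odd _ n) !mulr_sign; case: odd. Qed.

Lemma gr_eval_monoid x : GRing.monoid_morphism (gr_eval x).
Proof.
split=> [|s t]; apply/ffunP => K; rewrite !ffunE; first by case: eqP.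
rewrite Cinf_sumE; apply: eq_bigr => I _; rewrite Cinf_signE.
by rewrite !ffunE.
Qed.

HB.instance Definition _ x :=
  GRing.isZmodMorphism.Build _ _ (gr_eval x) (@gr_eval_zmod x).
HB.instance Definition _ x :=
  GRing.isMonoidMorphism.Build _ _ (gr_eval x) (@gr_eval_monoid x).

Lemma gr_evalP s t : (forall x, gr_eval x s = gr_eval x t) -> s = t.
Proof.
move=> st; apply/ffunP => K; apply/val_inj/funext => x /=.
by have /ffunP/(_ K) := st x; rewrite !ffunE.
Qed.

Lemma gr_eval_scale1 x (c : R) : gr_eval x (c *: (1 : superfun U q)) = gr_const q c.
Proof. by apply/ffunP => K; rewrite !ffunE; case: eqP => _; [exact: mulr1|exact: mulr0]. Qed.

Lemma gr_eval_even_coord x i : gr_eval x (even_coord q U i) = gr_const q (set_val x 0 i).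
Proof. by apply/ffunP => K; rewrite !ffunE; case: eqP. Qed.

End Evaluation.

(** * Smoothness of reciprocals *)

Section SmoothInverse.
Variables (R : realType) (p : nat) (U : set 'rV[R]_p).
Implicit Types f : 'rV[R]_p -> R.

(** The derivative of [1 / f] is the product of [- f'] and the square of [1 / f], so the induction
    only needs products. *)
Lemma CkV k f : open U -> (forall x, U x -> f x != 0) -> Ck U k f ->
  Ck U k (fun x => (f x)^-1).
Proof.
move=> oU f0; elim: k => [|k IH].
  by move=> cf x Ux; apply: continuousV; [exact: f0|exact: cf].
move=> cf; have cfV := IH (CkW cf); case: cf => [df Df]; split=> [x Ux|i].
  by apply: differentiableV; [exact: df|exact: f0].
have := CkM oU (CkM oU cfV cfV) (CkM oU (Ck_cst _ _ (-1)) (Df i)).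
apply: Ck_ext => // x Ux; rewrite deriveV; [|exact: f0|by apply: diff_derivable; exact: df].
by rewrite !fctE /GRing.scale /= -exprVn expr2; ring.
Qed.

End SmoothInverse.

(** * Homomorphisms on superfunctions are determined by the coordinates *)

Section CoordinatesDetermine.
Variables (R : realType) (p q : nat).

Definition Cinf_of (U : opens R p) (F : 'rV[R]_p -> R) (sF : smooth_on U F) : Cinf U :=
  MkCinf (introT (smooth_predP (F \o set_val)) (ex_intro2 _ _ F sF erefl)).

(** Hadamard's lemma as an identity in the ring of smooth functions, the form to which a ring
    homomorphism can be applied. *)
Lemma Cinf_hadamard (B : opens R p) (a : 'rV[R]_p) (r : R) (f : Cinf B) :
  0 < r -> opens_set B = ball a r ->
  exists c : R, exists G : 'I_p -> Cinf B,
    f = c *: (1 : Cinf B) + \sum_(i < p) (Cinf_coord B i - a 0 i *: (1 : Cinf B)) * G i.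
Proof.
case: f => f /= sf r0 BE; case: (elimT (smooth_predP f) sf) => F sF fF.
have [|G sG FE] := @hadamard R p a r F; first by rewrite -BE.
have sG' i : smooth_on B (G i) by rewrite BE.
exists (F a), (fun i => Cinf_of (sG' i)); apply/val_inj/funext => x /=.
rewrite fF /= FE; last by rewrite -BE; apply/set_mem; case: x.
rewrite -[RHS]/((F a *: (1 : Cinf B)) x +
  (\sum_(i < p) (Cinf_coord B i - a 0 i *: (1 : Cinf B)) * Cinf_of (sG' i)) x).
rewrite Cinf_sumE; congr (_ + _); first by rewrite [RHS]mulr1.
by apply: eq_bigr => i _; rewrite -[RHS]/((set_val x 0 i - a 0 i * 1) * G i (set_val x)) mulr1.
Qed.

Lemma gr_const_hadamard (B : opens R p) (a : 'rV[R]_p) (r : R) (f : Cinf B) :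
  0 < r -> opens_set B = ball a r ->
  exists c : R, exists G : 'I_p -> Cinf B,
    gr_const q f = c *: (1 : superfun B q) +
      \sum_(i < p) (even_coord q B i - a 0 i *: (1 : superfun B q)) * gr_const q (G i).
Proof.
move=> r0 BE; have [c [G ->]] := Cinf_hadamard f r0 BE; exists c, G.
have cD (f1 f2 : Cinf B) : gr_const q (f1 + f2) = gr_const q f1 + gr_const q f2.
  by apply/ffunP => K; rewrite !ffunE; case: eqP; rewrite ?addr0.
have cB (f1 f2 : Cinf B) : gr_const q (f1 - f2) = gr_const q f1 - gr_const q f2.
  by apply/ffunP => K; rewrite !ffunE; case: eqP; rewrite ?subr0.
have cM (f1 f2 : Cinf B) : gr_const q (f1 * f2) = gr_const q f1 * gr_const q f2.
  by apply/ffunP => K; rewrite gr_const_mulE !ffunE; case: eqP; rewrite ?mulr0.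
have cZ d : gr_const q (d *: (1 : Cinf B)) = d *: (1 : superfun B q).
  by apply/ffunP => K; rewrite !ffunE; case: eqP; rewrite ?scaler0.
rewrite cD cZ; congr (_ + _).
rewrite (big_morph (gr_const q) cD (_ : _ = 0)); last first.
  by apply/ffunP => K; rewrite !ffunE if_same.
apply: eq_bigr => i _; rewrite cM; congr (_ * _).
by rewrite cB cZ.
Qed.

(* By Hadamard's lemma the functions vanishing at the center of a ball lie in the ideal
   generated by the centered even coordinates, so no continuity of the homomorphisms is needed. *)
Lemma superfun_hom_ext (B : opens R p) (a : 'rV[R]_p) (r : R) (S : pzRingType)
    (phi psi : {rmorphism superfun B q -> S}) :
  0 < r -> opens_set B = ball a r ->
  (forall c : R, phi (c *: (1 : superfun B q)) = psi (c *: (1 : superfun B q))) ->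
  (forall j, phi (odd_coord B j) = psi (odd_coord B j)) ->
  (forall i, phi (even_coord q B i) = phi (a 0 i *: (1 : superfun B q))) ->
  (forall i, psi (even_coord q B i) = psi (a 0 i *: (1 : superfun B q))) ->
  phi =1 psi.
Proof.
move=> r0 BE phipsi_c phipsi_o phi_e psi_e s.
have const_eq f : phi (gr_const q f) = psi (gr_const q f).
  have [c [G ->]] := gr_const_hadamard f r0 BE.
  rewrite !rmorphD phipsi_c !rmorph_sum; congr (_ + _); apply: eq_bigr => i _.
  by rewrite !rmorphM !rmorphB phi_e psi_e !subrr !mul0r.
(* Induction on the number of generators, splitting off one at a time. *)
have mono_eq K : phi (gr_mono _ K) = psi (gr_mono _ K).
  have [N] := ubnP #|K|; elim: N K => // N IH K /ltnSE KN.
  have [->|[j jK]] := set_0Vmem K.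
    rewrite (_ : gr_mono _ _ = 1) ?rmorph1 //.
  rewrite (gr_mono_setD1 _ jK) !rmorphM !rmorphXn !rmorphN1; congr (_ * (_ * _)).
    by apply: IH; apply: leq_trans KN; rewrite [in ltnRHS](cardsD1 j) jK.
  exact: phipsi_o.
rewrite (gr_decomp s) !rmorph_sum; apply: eq_bigr => K _.
by rewrite !rmorphM const_eq mono_eq.
Qed.

Lemma res_even_coord (U V : opens R p) (h : V `<=` U) i :
  res h (even_coord q U i) = even_coord q V i.
Proof.
by apply/ffunP => K; rewrite !ffunE; case: eqP => _; apply/val_inj/funext.
Qed.

Lemma res_odd_coord (U V : opens R p) (h : V `<=` U) (j : 'I_q) :
  res h (odd_coord U j) = odd_coord V j.
Proof. by apply/ffunP => K; rewrite !ffunE rmorph_nat. Qed.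

End CoordinatesDetermine.

(** Naturality in the open set: it carries what is known about global pullbacks over to every open
    part of the target. *)
Lemma pull_res_global (R : realType) (p q r s : nat) (U : opens R p) (V : opens R r)
    (f : smorph q s U V) (W : opens R r) (h : W `<=` V) (hU : Defs.preim f W `<=` U)
    (a : superfun V s) :
  pull f h (res h a) = res hU (pull_global f a).
Proof.
rewrite (pull_res f (fun x (Vx : opens_set V x) => Vx) h h) /pull_global.
by rewrite (res_res (sub_preim f) hU (preim_sub (f:=f) h)).
Qed.

(** * Morphisms that fix all coordinates *)

Section Identity.
Variables (R : realType) (p q : nat) (U V : opens R p) (h : smorph q q U V).
Hypothesis h_even : forall i, pull_global h (even_coord q V i) = even_coord q U i.
Hypothesis h_odd : forall j : 'I_q, pull_global h (odd_coord V j) = odd_coord U j.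

Lemma preim_subl (W : opens R p) : Defs.preim h W `<=` U.
Proof. by move=> x []. Qed.

Lemma pull_even_coord (W : opens R p) (hW : W `<=` V) i :
  pull h hW (even_coord q W i) = even_coord q (Defs.preim h W) i.
Proof.
by rewrite -(res_even_coord q hW) (pull_res_global hW (@preim_subl W)) h_even res_even_coord.
Qed.

Lemma pull_odd_coord (W : opens R p) (hW : W `<=` V) (j : 'I_q) :
  pull h hW (odd_coord W j) = odd_coord (Defs.preim h W) j.
Proof.
by rewrite -(res_odd_coord hW) (pull_res_global hW (@preim_subl W)) h_odd res_odd_coord.
Qed.

Lemma pull_scale1 (W : opens R p) (hW : W `<=` V) (c : R) :
  pull h hW (c *: (1 : superfun W q)) = c *: (1 : superfun (Defs.preim h W) q).
Proof. by rewrite pull_scalable rmorph1. Qed.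

(** If [h x] and [x] differ in coordinate [i], put [c = x 0 i]. The i-th coordinate minus [c] is
    invertible around [h x], hence so is its pullback around [x]; but that pullback is the same
    expression, which vanishes at [x]. *)
Lemma smorph_body_id x : opens_set U x -> h x = x.
Proof.
move=> Ux; apply/rowP => i; apply/eqP; apply/negPn/negP => hxi.
set c := x 0 i in hxi.
have oW : open [set z : 'rV[R]_p | z 0 i != c].
  have := @coord_continuous R^o 1 p 0 i.
  move/continuousP/(_ [set t | t != c]); apply.
  exact: open_neq.
pose W := opensI V (Opens oW).
have hW : W `<=` V by move=> z [].
have sW : smooth_on W (fun z => (z 0 i - c)^-1).
  move=> k; apply: CkV; first exact: opensP.
    by move=> z [_] /=; rewrite subr_eq0.
  have := CkD (opensP W) (Ck_coord W k i) (Ck_cst W k (- c)); exact.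
pose e := even_coord q W i - c *: (1 : superfun W q).
pose e' := gr_const q (Cinf_of sW).
have e'e : e' * e = 1.
  apply/ffunP => K; rewrite gr_const_mulE !ffunE; case: eqP => _; apply/val_inj/funext => z.
    have [_ /= zc] : opens_set W (set_val z) by apply/set_mem; case: z.
    rewrite -[LHS]/((set_val z 0 i - c)^-1 * (set_val z 0 i - c * 1)) mulr1 mulVf //.
    by rewrite subr_eq0.
  by rewrite /= scaler0 subr0 mulr0.
have Wx : x \in (Defs.preim h W : set _).
  by apply: mem_set; split=> //; split; [exact: cmap_in|].
have := congr1 (gr_eval (SigSub Wx)) (congr1 (pull h hW) e'e).
(* Evaluated at [x], the pullback of [e' * e = 1] becomes [0 = 1]. *)
rewrite !rmorphM !rmorphB pull_even_coord pull_scale1 /= gr_eval_even_coord gr_eval_scale1.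
rewrite subrr mulr0 !rmorph1 => /esym; exact: gr_one_neq0.
Qed.

Lemma smorph_is_identity : is_identity h.
Proof.
have UV : U `<=` V by move=> x Ux; rewrite -(smorph_body_id Ux); exact: cmap_in.
exists UV; split=> [x Ux|W hW hh a]; first by rewrite smorph_body_id.
have pW : Defs.preim h W `<=` W by move=> x [Ux]; rewrite /= smorph_body_id.
(* The pullbacks are compared point by point; at each point both sides are restricted to a ball [B]
   inside [W], centered there. *)
rewrite /= (res_res _ _ pW); apply: gr_evalP => x.
have [Ux Wx] : opens_set (Defs.preim h W) (set_val x) by apply/set_mem; case: x.
set z := set_val x in Ux Wx; rewrite /= smorph_body_id // in Wx.
have [r /= r0 zW] := proj1 (nbhs_ballP _ _) (open_nbhs_nbhs (conj (opensP W) Wx)).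
pose B := Opens (ball_open z r).
have BsW : B `<=` W := zW.
have hB : B `<=` V by move=> y /BsW /hW.
have Bx : z \in (Defs.preim h B : set _).
  by apply: mem_set; split=> //=; rewrite smorph_body_id //; exact: ballxx.
have evB (s : superfun (Defs.preim h W) q) :
    gr_eval x s = gr_eval (SigSub Bx) (res (preim_sub (f:=h) BsW) s).
  by apply/ffunP => K; rewrite !ffunE /=; congr (s K _); apply: val_inj.
have pB : Defs.preim h B `<=` B by move=> y [Uy]; rewrite /= smorph_body_id.
have pBW : Defs.preim h B `<=` W by move=> y /pB /BsW.
rewrite !evB -(pull_res h hW hB BsW) (res_res _ _ pBW) -(res_res BsW pB).
(* Followed by evaluation at the center [z], both pullbacks send the i-th even coordinate to the
   constant [z 0 i]. *)
apply: (superfun_hom_ext (phi := gr_eval (SigSub Bx) \o pull h hB)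
  (psi := gr_eval (SigSub Bx) \o res pB) r0 erefl) => [c|j|i|i] /=.
- by rewrite pull_scale1 res_scalable rmorph1.
- by rewrite pull_odd_coord res_odd_coord.
- by rewrite pull_even_coord pull_scale1 gr_eval_even_coord gr_eval_scale1.
- by rewrite res_even_coord res_scalable rmorph1 gr_eval_even_coord gr_eval_scale1.
Qed.

End Identity.

(** * Pullbacks of global sections and composition *)

Section GlobalPullback.
Variables (R : realType) (p q r s : nat) (U : opens R p) (V : opens R r) (f : smorph q s U V).

Lemma pull_global_zmod : {morph pull_global f : a b / a - b}.
Proof. by move=> a b; rewrite /pull_global !rmorphB. Qed.

Lemma pull_global_monoid : GRing.monoid_morphism (pull_global f).
Proof. by split=> [|a b]; rewrite /pull_global ?rmorph1 ?rmorphM. Qed.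

HB.instance Definition _ :=
  GRing.isZmodMorphism.Build _ _ (pull_global f) pull_global_zmod.
HB.instance Definition _ :=
  GRing.isMonoidMorphism.Build _ _ (pull_global f) pull_global_monoid.

End GlobalPullback.

(** The inclusions are arguments so that any proofs of them can be supplied: [res_res] absorbs those
    inside restrictions, and proof irrelevance handles the one given to [pull]. *)
Lemma pull_global_comp (R : realType) (p q r s t u : nat) (U : opens R p) (V V' : opens R r)
    (X : opens R t) (f : smorph q s U V) (g : smorph s u V' X)
    (hV : opensI V (Defs.preim g X) `<=` V) (hV' : opensI V (Defs.preim g X) `<=` V')
    (hd : comp_dom V' f `<=` Defs.preim f (opensI V (Defs.preim g X))) (a : superfun X u) :
  pull_global (smorph_comp f g) a = res hd (pull f hV (res hV' (pull_global g a))).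
Proof.
rewrite /pull_global /= (res_res _ _ hd).
rewrite (res_res _ _ (@comp_subl _ _ _ _ _ V V' X g X)).
by rewrite (Prop_irrelevance hV (@comp_subr _ _ _ _ _ V V' X g X)).
Qed.

(** * Chart matrices and their behaviour under transition morphisms *)

Section Columns.
Variables (k l m n : nat) (IR : klindex k l m n).

Lemma sel_colP c : c \in cols IR -> exists r, c = sel_col IR r.
Proof.
move=> cI; exists (cast_ord (card_cols IR) (enum_rank_in cI c)).
by rewrite /sel_col cast_ordK enum_rankK_in.
Qed.

Lemma sel_colK (A : pzRingType) (Q : 'M[A]_(k + l)) (Y : 'M[A]_(k + l, m + n)) r r' :
  (Q *m Y) r (sel_col IR r') = (Q *m Mcols IR Y) r r'.
Proof. by rewrite !mxE; apply: eq_bigr => i _; rewrite !mxE. Qed.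

Lemma free_pos_uniq b : uniq (free_pos IR b).
Proof.
apply: filter_uniq; apply: allpairs_uniq; rewrite ?enum_uniq //.
by move=> [c r] [c' r'] _ _ /= [-> ->].
Qed.

Lemma mem_free_pos b rc : rc \in free_pos IR b ->
  rc.2 \notin cols IR /\ even_block rc.1 rc.2 = b.
Proof.
rewrite mem_filter => /andP[/eqP <-] /allpairsPdep[c [r [+ _ ->]]].
by rewrite mem_enum inE.
Qed.

End Columns.

Section Transitions.
Variables (R : realType) (k l m n : nat).
Implicit Types IR JS KT : klindex k l m n.
Notation p := (alpha k l m n).
Notation q := (beta k l m n).
Implicit Types U V W X : opens R p.

Lemma res_Amx IR U V (h : V `<=` U) : map_mx (res h) (Amx IR U) = Amx IR V.
Proof.
apply/matrixP => r c; rewrite !mxE /even_gen /odd_gen.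
case: ifP => _; first by rewrite rmorph_nat.
by case: ifP => _; case: insub => [i|]; rewrite ?rmorph0 ?res_even_coord ?res_odd_coord.
Qed.

Lemma Amx_sel_col IR W r r' : Amx IR W r (sel_col IR r') = (r == r')%:R.
Proof. by have /matrixP/(_ r r') := Mcols_Amx IR W; rewrite mxE [RHS]mxE. Qed.

(** The list of even free positions has length alpha and no repetition, so its i-th position carries
    exactly the i-th generator. *)
Lemma Amx_even_coord IR (i : 'I_p) :
  exists r c, forall W, Amx IR W r c = even_coord q W i.
Proof.
(* A default value for [nth], which exists because the list is nonempty. *)
have rc0 : 'I_(k + l) * 'I_(m + n).
  have : (i < size (free_pos IR true))%N by rewrite size_free_pos.
  by case: (free_pos IR true).
have isz : (i < size (free_pos IR true))%N by rewrite size_free_pos.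
have [cI eb] := mem_free_pos (mem_nth rc0 isz).
exists (nth rc0 (free_pos IR true) i).1, (nth rc0 (free_pos IR true) i).2.
move=> W; rewrite mxE (negPf cI) eb -surjective_pairing index_uniq ?free_pos_uniq //.
by rewrite /even_gen valK.
Qed.

Lemma Amx_odd_coord IR (j : 'I_q) :
  exists r c, forall W, Amx IR W r c = odd_coord W j.
Proof.
have rc0 : 'I_(k + l) * 'I_(m + n).
  have : (j < size (free_pos IR false))%N by rewrite size_free_pos.
  by case: (free_pos IR false).
have jsz : (j < size (free_pos IR false))%N by rewrite size_free_pos.
have [cI eb] := mem_free_pos (mem_nth rc0 jsz).
exists (nth rc0 (free_pos IR false) j).1, (nth rc0 (free_pos IR false) j).2.
move=> W; rewrite mxE (negPf cI) eb -surjective_pairing index_uniq ?free_pos_uniq //.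
by rewrite /odd_gen valK.
Qed.

(** Leaving the multiplier existential makes the property stable under composition without tracking
    products of inverses. *)
Definition pulls_to_left_multiple IR JS U V (f : smorph q q U V) : Prop :=
  exists Q : 'M[superfun U q]_(k + l), map_mx (pull_global f) (Amx JS V) = Q *m Amx IR U.

Lemma transition_pulls_to_left_multiple IR JS (g : smorph q q (overlap R IR JS) (overlap R JS IR)) :
  is_transition g -> pulls_to_left_multiple IR JS g.
Proof.
case=> N [_ NM] gD; exists N; apply/matrixP => r c.
have [/sel_colP[r' ->]|cJ] := boolP (c \in cols JS).
  by rewrite sel_colK NM !(Amx_sel_col, mxE) rmorph_nat.
have cJ' : c \in (~: cols JS)%SET by rewrite inE.
have /matrixP/(_ r (enum_rank_in cJ' c)) := gD.
rewrite [LHS]mxE [X in pull_global _ X]mxE [RHS]mxE enum_rankK_in // => <-.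
by rewrite mxE.
Qed.

(** Writing [f^*] for the pullback, the composite sends the matrix of [KT] to
    [f^*(Q A_J) = f^*(Q) P A_I]. *)
Lemma comp_pulls_to_left_multiple IR JS KT U V V' X (f : smorph q q U V) (g : smorph q q V' X) :
  pulls_to_left_multiple IR JS f -> pulls_to_left_multiple JS KT g ->
  pulls_to_left_multiple IR KT (smorph_comp f g).
Proof.
case=> P fP [Q gQ].
have hV : opensI V (Defs.preim g X) `<=` V by move=> x [].
have hV' : opensI V (Defs.preim g X) `<=` V' by move=> x [_ []].
have hd : comp_dom V' f `<=` Defs.preim f (opensI V (Defs.preim g X)).
  move=> x [Ux V'x]; split=> //; split; first exact: cmap_in.
  by split=> //; exact: (@cmap_in _ _ _ _ _ g _ V'x).
have hU : Defs.preim f (opensI V (Defs.preim g X)) `<=` U by move=> x [].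
have hdU : comp_dom V' f `<=` U by move=> x [].
(* [F] is the pullback along [f] of functions on [V'], which must first be restricted to a part of
   [V]. *)
pose F : {rmorphism superfun V' q -> superfun (comp_dom V' f) q} :=
  res hd \o (pull f hV \o res hV').
exists (map_mx F Q *m map_mx (res hdU) P).
transitivity (map_mx F (Q *m Amx JS V')).
  by rewrite -gQ; apply/matrixP => r c; rewrite !mxE; exact: pull_global_comp.
rewrite -mulmxA -(res_Amx IR hdU) -map_mxM -fP map_mxM; congr (_ *m _).
(* The matrices of [JS] over [V] and [V'] have the same restriction, so on these entries [F] agrees
   with the global pullback of [f]. *)
have resA (W1 W2 : opens R p) (h : W2 `<=` W1) r c : res h (Amx JS W1 r c) = Amx JS W2 r c.
  by rewrite -(res_Amx JS h) [RHS]mxE.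
apply/matrixP => r c.
rewrite [LHS]mxE [RHS]mxE /= [X in res hdU X]mxE (resA _ _ hV') -(resA _ _ hV).
by rewrite (pull_res_global hV hU) (res_res hU hd hdU).
Qed.

Lemma pulls_to_left_multiple_identity IR U V (h : smorph q q U V) :
  pulls_to_left_multiple IR IR h -> is_identity h.
Proof.
case=> Q hQ.
(* In the columns of [IR] the matrix is the identity both before and after pulling back. *)
have Q1 : Q = 1%:M.
  rewrite -[LHS]mulmx1 -(Mcols_Amx IR U); apply/matrixP => r r'.
  by rewrite -sel_colK -hQ !(Amx_sel_col, mxE) rmorph_nat.
have hA r c : pull_global h (Amx IR V r c) = Amx IR U r c.
  by move/matrixP/(_ r c): hQ; rewrite Q1 mul1mx mxE.
apply: smorph_is_identity => [i|j].
  have [r [c iE]] := Amx_even_coord IR i.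
  by rewrite -(iE V) -(iE U).
have [r [c jE]] := Amx_odd_coord IR j.
by rewrite -(jE V) -(jE U).
Qed.

End Transitions.

Theorem proposition2p1 (R : realType) (k l m n : nat)
  (hk : (k <= m)%N) (hl : (l <= n)%N)
  (g : forall IR JS : klindex k l m n,
     smorph (beta k l m n) (beta k l m n) (overlap R IR JS) (overlap R JS IR))
  (hg : forall IR JS : klindex k l m n, is_transition (g IR JS))
  (IR JS KT : klindex k l m n) :
  is_identity (g IR IR) /\
  is_identity (smorph_comp (g IR JS) (g JS IR)) /\
  is_identity (smorph_comp (smorph_comp (g IR JS) (g JS KT)) (g KT IR)).
Proof.
have req IR' JS' := transition_pulls_to_left_multiple (hg IR' JS').
split; first by apply: pulls_to_left_multiple_identity (req IR IR).
split; apply: (@pulls_to_left_multiple_identity _ _ _ _ _ IR).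
  exact: comp_pulls_to_left_multiple (req IR JS) (req JS IR).
apply: comp_pulls_to_left_multiple (req KT IR).
exact: comp_pulls_to_left_multiple (req IR JS) (req JS KT).
Qed.
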